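(* Let $p\ge1$, $\alpha\in(0,1)$, let $\mathcal X\subset\mathbb R^\ell$ be closed and convex, and let $\Xi\subset\mathbb R^d=\mathbb R^{d_1}\times\cdots\times\mathbb R^{d_n}$ be closed. Let $Q=\sum_{l=1}^M\vartheta_l\delta_{\xi^l}$ be a discrete distribution with atoms $\xi^1,\ldots,\xi^M\in\Xi$ and masses $\vartheta_1,\ldots,\vartheta_M$, and let $\bm\varepsilon=(\varepsilon_1,\ldots,\varepsilon_n)\succeq0$. Suppose that $f:\mathcal X\times\Xi\to\mathbb R$ is such that: for each $\xi\in\Xi$, the function $x\mapsto f(x,\xi)$ is convex; and there exists $r\in[0,p)$ such that for each $x\in\mathcal X$ the function $\xi\mapsto f(x,\xi)$ is continuous and belongs to $\mathcal G_r$. Then the set $$\Big\{x\in\mathcal X:\ \sup_{P\in\mathcal T_p(Q,\bm\varepsilon)}\inf_{\tau\in\mathbb R}\mathbb E_P[(f(x,\xi)+\tau)_+-\tau\alpha]\le0\Big\}$$ consists of all $x\in\mathcal X$ for which the convex constraints $$\begin{aligned}&\sum_{k=1}^n\lambda_k\varepsilon_k^p+\sum_{l=1}^M\vartheta_l s_l\le\tau\alpha,\\ &\sup_{\xi\in\Xi}\Big\{f(x,\xi)+\tau-\sum_{k=1}^n\lambda_k\|\xi_k-\xi_k^l\|^p\Big\}\le s_l,\qquad l\in[M],\end{aligned}$$ are met for some $\bm\lambda=(\lambda_1,\ldots,\lambda_n)\succeq0$, $\tau\in\mathbb R$, and $s_l\ge0$, $l\in[M]$.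
   Context: Notation: $[N]:=\{1,\ldots,N\}$; $x_+:=\max\{x,0\}$; for vectors, $\succeq0$ means all components are nonnegative; elements of $\mathbb R^d$ are written $\xi=(\xi_1,\ldots,\xi_n)$ with $\xi_k\in\mathbb R^{d_k}$ (so $\xi^l_k$ is the $k$th block of the atom $\xi^l$), and each $\mathbb R^{d_k}$ (and $\mathbb R^d$) carries an arbitrary norm denoted $\|\cdot\|$. $\mathcal P(\cdot)$ denotes Borel probability measures. $\mathcal G_r$ is the class of functions $h:\Xi\to\mathbb R$ for which there are $C>0$ and $\zeta\in\Xi$ such that $h(\xi)\le C(1+\|\zeta-\xi\|^r)$ for all $\xi\in\Xi$, and likewise for $-h$. The multi-transport hyperrectangle is $$\mathcal T_p(Q,\bm\varepsilon):=\Big\{\mathrm{pr}_{2\#}\pi:\ \pi\in\mathcal P(\Xi\times\Xi),\ \mathrm{pr}_{1\#}\pi=Q,\ \int_{\Xi\times\Xi}\|\zeta_k-\xi_k\|^p\,d\pi(\zeta,\xi)\le\varepsilon_k^p\ \text{for all }k\in[n]\Big\},$$ where $\mathrm{pr}_{1\#}\pi,\mathrm{pr}_{2\#}\pi$ are the first and second marginals of $\pi$.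
   Formalization: If some ε_k = 0 the equality can fail with finite λ, so it is proved as stated when all ε_k > 0, and for all ε ⪰ 0 with λ_k in [0,+∞] (∞·0 = 0); for ε ⪰ 0 the finite-λ set is shown to lie in the robust set. Masses are taken positive. *)

(* Defs.v *)
From HB Require Import structures.
From mathcomp Require Export all_boot all_order all_algebra.
From mathcomp Require Export all_classical all_reals all_analysis.

Set Implicit Arguments.
Unset Strict Implicit.
Unset Printing Implicit Defensive.

Import Order.TTheory GRing.Theory Num.Theory.
Import numFieldNormedType.Exports.

Local Open Scope classical_set_scope.
Local Open Scope ring_scope.

Definition is_norm (R : realType) (V : lmodType R) (N : V -> R) : Prop :=
  [/\ forall v, N v = 0 -> v = 0,
      forall (a : R) v, N (a *: v) = `|a| * N v
    & forall u v, N (u + v) <= N u + N v].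

(* R^m with its Borel sigma-algebra *)
Definition borel_rV (R : realType) (m : nat) :=
  g_sigma_algebraType (@open 'rV[R]_m).

(* convexity of a function with values in the extended reals; under the
   library convention 0 * +oo = 0 the cases t = 0 and t = 1 are trivial *)
Definition econvex_function (R : realType) (E : lmodType R) (D : set E)
    (g : E -> \bar R) : Prop :=
  forall (t : R) (y z : E), 0 <= t <= 1 -> D y -> D z ->
    (g (t *: y + (1 - t) *: z)%R <= t%:E * g y + (1 - t)%:E * g z)%E.

(* The space R^d = R^(d_1) x ... x R^(d_n) is 'rV[R]_(\sum_k d k), and the
   k-th block of xi is submxrow xi k : 'rV[R]_(d k). *)
Section Blocks.
Context (R : realType) (n : nat) (d : 'I_n -> nat).
Local Notation D := (\sum_k d k)%N.
Implicit Types (Xi : set 'rV[R]_D) (p alpha tau : R) (eps lam : 'rV[R]_n).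

Definition growth_bound Xi (N : 'rV[R]_D -> R) (r : R)
    (h : 'rV[R]_D -> R) : Prop :=
  exists C zeta, [/\ 0 < C, Xi zeta &
    forall xi, Xi xi -> h xi <= C * (1 + N (zeta - xi) `^ r)].

Definition growth_class Xi (N : 'rV[R]_D -> R) (r : R)
    (h : 'rV[R]_D -> R) : Prop :=
  growth_bound Xi N r h /\ growth_bound Xi N r (fun xi => - h xi).

Definition block_cost (N : forall k, 'rV[R]_(d k) -> R) p
    (zeta xi : 'rV[R]_D) (k : 'I_n) : R :=
  N k (submxrow zeta k - submxrow xi k) `^ p.

(* Probability measures on Xi are represented by those on R^d giving mass 1
   to Xi.  The product sigma-algebra used for the plan is the Borel one, since
   R^d is second countable. *)
Definition transport_rectangle Xi (N : forall k, 'rV[R]_(d k) -> R) p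
    (Q : probability (borel_rV R D) R) eps :
    set (probability (borel_rV R D) R) :=
  [set P | exists pi : probability (borel_rV R D * borel_rV R D)%type R,
    [/\ pi (Xi `*` Xi) = 1%E,
        forall A, measurable A -> pushforward pi fst A = Q A,
        forall A, measurable A -> pushforward pi snd A = P A
      & forall k, (\int[pi]_(z in Xi `*` Xi) (block_cost N p z.1 z.2 k)%:E
                   <= (eps 0 k `^ p)%:E)%E]].

Section Constraints.
Context (ell M : nat) (X : set 'rV[R]_ell) (Xi : set 'rV[R]_D).
Context (N : forall k, 'rV[R]_(d k) -> R) (p alpha : R).
Context (theta : 'I_M -> R) (atom : 'I_M -> 'rV[R]_D) (eps : 'rV[R]_n).
Context (f : 'rV[R]_ell -> 'rV[R]_D -> R).

Definition robust_set (Q : probability (borel_rV R D) R) : set 'rV[R]_ell :=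
  [set x | X x /\
    (ereal_sup [set ereal_inf [set
         \int[P]_(xi in Xi) (Num.max (f x xi + tau) 0 - tau * alpha)%:E
       | tau in [set: R]]
     | P in transport_rectangle Xi N p Q eps] <= 0)%E].

Definition budget_lhs (lam : 'rV[R]_n) (s : 'rV[R]_M) : R :=
  \sum_k lam 0 k * eps 0 k `^ p + \sum_l theta l * s 0 l.

Definition penalized_sup (x : 'rV[R]_ell) (lam : 'rV[R]_n) (tau : R)
    (l : 'I_M) : \bar R :=
  ereal_sup [set (f x xi + tau
                  - \sum_k lam 0 k * block_cost N p xi (atom l) k)%:E
            | xi in Xi].

Definition reformulated_set : set 'rV[R]_ell :=
  [set x | X x /\ exists (lam : 'rV[R]_n) (tau : R) (s : 'rV[R]_M),
    [/\ forall k, 0 <= lam 0 k, forall l, 0 <= s 0 l,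
        budget_lhs lam s <= tau * alpha
      & forall l, (penalized_sup x lam tau l <= (s 0 l)%:E)%E]].

(* Same constraints with multipliers in [0, +oo].  As +oo * 0 = 0, the
   multiplier +oo is affordable only for a block with a zero budget, and it
   then forces xi_k = xi_k^l in the supremum.  Finite multipliers do not
   suffice for a zero budget: for n = p = M = 1, d = 1, atom 0, eps = 0,
   Xi = R and f x xi = sqrt |xi|, robust_set is X, whereas
   reformulated_set is empty since the penalized supremum at a finite
   multiplier lam > 0 is tau + 1 / (4 * lam). *)
Definition ereformulated_set : set 'rV[R]_ell :=
  [set x | X x /\ exists (lam : 'I_n -> \bar R) (tau : R) (s : 'rV[R]_M),
    [/\ forall k, (0 <= lam k)%E, forall l, 0 <= s 0 l,
        (\sum_k lam k * (eps 0 k `^ p)%:E + (\sum_l theta l * s 0 l)%:E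
         <= (tau * alpha)%:E)%E
      & forall l,
        (ereal_sup [set (f x xi + tau)%:E
                        - \sum_k lam k * (block_cost N p xi (atom l) k)%:E
                   | xi in Xi]
         <= (s 0 l)%:E)%E]].

(* Joint convexity of the constraint functions in (x, lam, tau, s). *)
Definition constraints_convex : Prop :=
  let V := ('rV[R]_ell * 'rV[R]_n * R^o * 'rV[R]_M)%type in
  let dom : set V :=
    [set v : V | [/\ X v.1.1.1, forall k, 0 <= v.1.1.2 0 k
               & forall l, 0 <= v.2 0 l]] in
  econvex_function dom
    (fun v : V => (budget_lhs v.1.1.2 v.2 - v.1.2 * alpha)%:E) /\
  forall l, econvex_function dom
    (fun v : V => (penalized_sup v.1.1.1 v.1.1.2 v.1.2 l - (v.2 0 l)%:E)%E).

End Constraints.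
End Blocks.

(* Main.v *)
From HB Require Import structures.
Require Import Defs.
From mathcomp Require Import all_boot all_order all_algebra finmap.
From mathcomp Require Import all_classical all_reals all_analysis.
From mathcomp Require Import measurable_realfun.
From mathcomp Require Import ring lra.
Import Order.TTheory GRing.Theory Num.Theory.
Import numFieldNormedType.Exports.
Import HBNNSimple.
Local Open Scope classical_set_scope.
Local Open Scope ring_scope.

(* As Q is discrete, the system in (lam, tau, s) is semi-infinite linear, with
   one constraint for each pair of an atom l and a point xi. Any finite
   subsystem is either solvable or, by Farkas' lemma, has a certificate: a
   weight u_j for each pair (l_j, xi_j), of total alpha, with at most theta_l
   on the pairs of atom l and with transport costs within the budgets, such
   that sum_j u_j f(xi_j) > 0. Moving u_j from the atom l_j to xi_j and leaving
   the remaining mass in place gives an admissible P with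
   E_P[(f + tau)_+] - tau alpha >= sum_j u_j f(xi_j) > 0 for every tau. So if x
   is robust, all finite subsystems are solvable. The constraints at the atoms
   themselves confine their solutions to a fixed box, because alpha < 1, and
   compactness solves the whole system. The converse is weak duality: one
   integrates the constraints against a transport plan. *)

Set Implicit Arguments.
Unset Strict Implicit.
Unset Printing Implicit Defensive.

(** * Finite systems of linear inequalities: Farkas' lemma *)

Section Farkas.
Context {R : realFieldType}.

(** The largest lower bound serves; if there is none, the smallest upper bound does, and without any
    bounds [0] is as good as any number. *)
Lemma separating_point (I : finType) (P U : pred I) (L H : I -> R) :
  (forall i j, U i -> P j -> L j <= H i) ->
  exists t, (forall j, P j -> L j <= t) /\ (forall i, U i -> t <= H i).
Proof.
move=> LH; case: (pickP P) => [j0 Pj0|P0].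
  exists (L [arg max_(j > j0 | P j) L j]%O).
  by case: arg_maxP => // j Pj jmax; split=> [k /jmax//|i Ui]; exact: LH.
case: (pickP U) => [i0 Ui0|U0].
  exists (H [arg min_(i < i0 | U i) H i]%O).
  case: arg_minP => // i Ui imin; split=> [k|k /imin//].
  by rewrite P0.
by exists 0; split=> k; rewrite ?P0 ?U0.
Qed.

(* Fourier-Motzkin elimination, one variable at a time. *)
Lemma farkas_seq (V : eqType) (vs : seq V) : uniq vs ->
  forall (I : finType) (a : I -> V -> R) (b : I -> R),
  (exists x : V -> R, forall i, \sum_(v <- vs) a i v * x v + b i <= 0) \/
  (exists w : I -> R, [/\ forall i, 0 <= w i,
     forall v, v \in vs -> \sum_i w i * a i v = 0 & 0 < \sum_i w i * b i]).
Proof.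
elim: vs => [_|u vs IH /= /andP[uvs uniq_vs]] I a b.
  case: (pickP (fun i => 0 < b i)) => [i bi|b0].
    right; exists (fun j => (j == i)%:R); split=> //.
    rewrite (bigD1 i)//= eqxx mul1r big1 ?addr0// => j /negbTE ->.
    by rewrite mul0r.
  left; exists (fun=> 0) => i; rewrite big_nil add0r leNgt.
  by rewrite b0.
(* A pair [q] stands for the combination of rows [q.1] and [q.2] with coefficients [c1 q] and
   [c2 q], from which [u] has disappeared: row [q.1] itself if [u] does not occur in it, the
   positive combination of an upper and a lower bound on [u], and the zero row for all other
   pairs. *)
pose c1 (q : I * I) : R := if a q.1 u == 0 then 1 else
  if (0 < a q.1 u) && (a q.2 u < 0) then - a q.2 u else 0.
pose c2 (q : I * I) : R := if a q.1 u == 0 then 0 else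
  if (0 < a q.1 u) && (a q.2 u < 0) then a q.1 u else 0.
have c1_ge0 q : 0 <= c1 q.
  by rewrite /c1; case: ifP => // _; case: ifP => // /andP[_]; lra.
have c2_ge0 q : 0 <= c2 q.
  by rewrite /c2; case: ifP => // _; case: ifP => // /andP[+ _]; lra.
have c12 q : c1 q * a q.1 u + c2 q * a q.2 u = 0.
  rewrite /c1 /c2; case: eqP => [->|_]; first by rewrite mulr0 mul0r addr0.
  by case: ifP => _; ring.
case: (IH uniq_vs (I * I)%type (fun q v => c1 q * a q.1 v + c2 q * a q.2 v)
  (fun q => c1 q * b q.1 + c2 q * b q.2)) => [[x hx]|[w [w0 wa wb]]].
- left; pose g i := \sum_(v <- vs) a i v * x v + b i.
  have hg q : c1 q * g q.1 + c2 q * g q.2 <= 0.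
    apply: le_trans (hx q); rewrite /g !mulrDr !mulr_sumr addrACA.
    by rewrite lerD2r -big_split/= ler_sum// => v _; lra.
  (* The combined rows say that each lower bound on [u] lies below each upper bound, so a value for
     [u] fits in between. *)
  have [t [tL tH]] : exists t, (forall j, a j u < 0 -> g j / - a j u <= t) /\
      (forall i, 0 < a i u -> t <= - g i / a i u).
    apply: (@separating_point I (fun j => a j u < 0) (fun i => 0 < a i u)).
    move=> i j ai aj; rewrite ler_pdivrMr ?oppr_gt0// mulrAC ler_pdivlMr//.
    have := hg (i, j); rewrite /c1 /c2/= gt_eqF// ai aj/=; lra.
  exists (fun v => if v == u then t else x v) => i.
  rewrite big_cons eqxx -addrA.
  rewrite (eq_big_seq (fun v => a i v * x v)) => [|v vvs]; last first.
    by case: eqP uvs => // <-; rewrite vvs.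
  rewrite -/(g i); case: (ltgtP (a i u) 0) => ai.
  + by have := tL _ ai; rewrite ler_pdivrMr ?oppr_gt0//; lra.
  + by have := tH _ ai; rewrite ler_pdivlMr//; lra.
  + by have := hg (i, i); rewrite /c1 /c2/= ai eqxx; lra.
(* A certificate on pairs pulls back to the rows: row [i] collects its share from all pairs that
   contain it, in either position. *)
- right; pose w' i := \sum_j (w (i, j) * c1 (i, j) + w (j, i) * c2 (j, i)).
  have w'E (y : I -> R) :
      \sum_i w' i * y i = \sum_q w q * (c1 q * y q.1 + c2 q * y q.2).
    under eq_bigr do rewrite mulr_suml.
    under eq_bigr do under eq_bigr do rewrite mulrDl.
    under eq_bigr do rewrite big_split/=.
    rewrite big_split/= [X in _ + X]exchange_big/= !pair_bigA/= -big_split/=.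
    by apply: eq_bigr => -[i j] _ /=; ring.
  exists w'; split.
  + by move=> i; apply: sumr_ge0 => j _; rewrite addr_ge0// mulr_ge0.
  + move=> v; rewrite w'E inE => /predU1P[->|/wa//].
    by rewrite big1// => q _; rewrite c12 mulr0.
  + by rewrite w'E.
Qed.

End Farkas.

(** * Monotonicity of integrals of nonnegative functions, measurable or not *)

Section NonmeasurableMonotonicity.
Local Open Scope ereal_scope.
Context d (T : measurableType d) (R : realType).
Variable mu : {measure set T -> \bar R}.

(** The integral of a nonnegative function is a supremum over the simple functions below it, and
    this family grows with the function. In this way transport costs are compared without joint
    measurability of [block_cost] in its two points. *)
Lemma ge0_le_integral_nonmeasurable (D : set T) (f g : T -> \bar R) :
  (forall x, D x -> 0 <= f x) -> (forall x, D x -> f x <= g x) ->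
  \int[mu]_(x in D) f x <= \int[mu]_(x in D) g x.
Proof.
move=> f0 fg; rewrite !ge0_integralE//; last first.
  by move=> x Dx; rewrite (le_trans (f0 _ Dx))// fg.
apply: le_ereal_sup => _ [h hf <-]; exists h => //= x.
by rewrite (le_trans (hf x))// lee_restrict.
Qed.

Lemma ge0_le_integral_subset (A B : set T) (f : T -> \bar R) :
  (forall x, B x -> 0 <= f x) -> A `<=` B ->
  \int[mu]_(x in A) f x <= \int[mu]_(x in B) f x.
Proof.
move=> f0 AB; rewrite integral_mkcond [leRHS]integral_mkcond.
apply: ge0_le_integral_nonmeasurable => x _; rewrite !patchE.
  by case: ifPn => //; rewrite inE => /AB/f0.
case: ifPn => [/set_mem/AB/mem_set-> //|_].
by case: ifPn => //; rewrite inE => /f0.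
Qed.

End NonmeasurableMonotonicity.

(** * Finitely supported measures and probabilities *)

Section FiniteMixtures.
Local Open Scope ereal_scope.
Context d (T : measurableType d) (R : realType).

Lemma finite_measure_seq (J : Type) (s : seq J) (w : J -> R) (z : J -> T) :
  (forall j, 0 <= w j)%R ->
  exists mu : {measure set T -> \bar R},
    (forall A, mu A = \sum_(j <- s) (w j)%:E * \d_(z j) A) /\
    (forall D (f : T -> \bar R), measurable D -> measurable_fun D f ->
      (forall x, D x -> 0 <= f x) ->
      \int[mu]_(x in D) f x = \sum_(j <- s) (w j)%:E * (\d_(z j) D * f (z j))).
Proof.
move=> w0; elim: s => [|j s [mu [muE intmu]]].
  exists mzero; split=> [A|D f mD mf f0]; first by rewrite big_nil.
  by rewrite big_nil integral_measure_zero.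
exists (measure_add (mscale (NngNum (w0 j)) (\d_(z j))) mu); split.
  by move=> A; rewrite big_cons -muE [LHS]measure_addE.
move=> D f mD mf f0; rewrite big_cons ge0_integral_measure_add// intmu//.
by rewrite ge0_integral_mscale// integral_dirac.
Qed.

(** A copy of [mu] indexed by the proof that its mass is one, so that the structure of a probability
    can be attached to it. *)
Definition unit_measure (mu : {measure set T -> \bar R}) & mu setT = 1 :
  set T -> \bar R := mu.

HB.instance Definition _ (mu : {measure set T -> \bar R}) (mu1 : mu setT = 1) :=
  Measure.on (unit_measure mu1).
HB.instance Definition _ (mu : {measure set T -> \bar R}) (mu1 : mu setT = 1) :=
  Measure_isProbability.Build d T R (unit_measure mu1) mu1.

(** The last clause is for integrands that may fail to be measurable, such as transport costs: every
    simple function below [f] is integrated exactly, and its values at the support points are at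
    most those of [f]. *)
Lemma finite_probability (J : finType) (w : J -> R) (z : J -> T) :
  (forall j, 0 <= w j)%R -> (\sum_j w j = 1)%R ->
  exists P : probability T R,
  [/\ forall A, P A = \sum_j (w j)%:E * \d_(z j) A,
    forall D (f : T -> \bar R), measurable D -> measurable_fun D f ->
      (forall x, D x -> 0 <= f x) ->
      \int[P]_(x in D) f x = \sum_j (w j)%:E * (\d_(z j) D * f (z j))
  & forall D (f : T -> \bar R), (forall j, D (z j)) ->
      (forall x, D x -> 0 <= f x) ->
      \int[P]_(x in D) f x <= \sum_j (w j)%:E * f (z j)].
Proof.
move=> w0 w1; have [mu [muE intmu]] := @finite_measure_seq J (index_enum J) w z w0.
have mu1 : mu setT = 1.
  rewrite muE -[RHS](congr1 EFin w1) -sumEFin; apply: eq_bigr => j _.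
  by rewrite diracT mule1.
exists (unit_measure mu1); split=> // D f Dz f0; rewrite ge0_integralE//.
apply: ge_ereal_sup => _ [h /= hf <-].
rewrite -integralT_nnsfun intmu//; last by move=> x _; rewrite lee_fin.
  apply: lee_sum => j _; rewrite diracT mul1e lee_wpmul2l// ?lee_fin//.
  by have := hf (z j); rewrite patchE mem_set.
exact/measurable_EFinP.
Qed.

End FiniteMixtures.

(** * Splitting a constant off an expectation *)

Section ShiftedExpectation.
Local Open Scope ereal_scope.
Context d (T : measurableType d) (R : realType) (P : probability T R).

Lemma integralB_cst (D : set T) (h : T -> R) (c : R) : measurable D -> P D = 1 ->
  measurable_fun D h -> (forall x, D x -> 0 <= h x)%R ->
  \int[P]_(x in D) (h x)%:E < +oo ->
  \int[P]_(x in D) (h x - c)%:E = \int[P]_(x in D) (h x)%:E - c%:E.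
Proof.
move=> mD PD mh h0 hoo; under eq_integral do rewrite EFinB.
rewrite (@integralB_EFin _ _ _ P D h (cst c))//.
- congr (_ - _).
  by rewrite [LHS](integral_cst P mD c%:E) [X in (_ * X)%E]PD mule1.
- apply/integrableP; split; first exact/measurable_EFinP.
  rewrite (eq_integral (EFin \o h))// => x /set_mem Dx /=.
  by rewrite ger0_norm// h0.
- apply/integrableP; split; first exact/measurable_EFinP.
  rewrite (eq_integral (cst `|c|%:E))// [ltLHS](integral_cst P mD).
  by rewrite [X in (_ * X)%E]PD mule1 ltry.
Qed.

End ShiftedExpectation.

(** * Borel measurability on row vectors *)

Section Borel.
Context {R : realType} {m : nat}.
Implicit Types A : set 'rV[R]_m.

Lemma open_borel_rV A : open A -> measurable (A : set (borel_rV R m)).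
Proof. by move=> oA; exact: sub_sigma_algebra. Qed.

Lemma closed_borel_rV A : closed A -> measurable (A : set (borel_rV R m)).
Proof.
move=> /closed_openC/open_borel_rV oA.
rewrite -[X in measurable X]setCK; exact: measurableC.
Qed.

(** Open intervals generate the Borel sets of the line. The preimage of one in [A] is the trace on
    [A] of an open set, and [A] itself is Borel. *)
Lemma within_continuous_borel_rV A (g : 'rV[R]_m -> R) : closed A ->
  {within A, continuous g} -> measurable_fun (A : set (borel_rV R m)) g.
Proof.
move=> cA cg; apply: (measurability _ (RGenOpens.measurableE R)).
move=> _ [_ [a [b ->] <-]].
have /continuousP/(_ _ (interval_open _ _)) : continuous (g : subspace A -> R) by [].
move=> /(_ (BRight a) (BLeft b) isT isT) /open_subspaceP[V oV VA].
rewrite setIC -VA; apply: measurableI; [exact: open_borel_rV|exact: closed_borel_rV].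
Qed.

Lemma continuous_borel_rV (g : 'rV[R]_m -> R) : continuous g ->
  measurable_fun [set: borel_rV R m] g.
Proof.
move=> cg; apply: within_continuous_borel_rV; first exact: closedT.
exact: continuous_subspaceT.
Qed.

End Borel.

(** * Continuity of seminorms *)

Section Seminorm.
Context {R : realType} {m : nat} (N : 'rV[R]_m -> R).
Hypothesis NZ : forall (a : R) v, N (a *: v) = `|a| * N v.
Hypothesis NT : forall u v, N (u + v) <= N u + N v.

Lemma seminorm0 : N 0 = 0.
Proof. by rewrite -(scale0r 0) NZ normr0 mul0r. Qed.

Lemma seminormN v : N (- v) = N v.
Proof. by rewrite -scaleN1r NZ normrN1 mul1r. Qed.

Lemma seminorm_ge0 v : 0 <= N v.
Proof. by have := NT v (- v); rewrite subrr seminorm0 seminormN; lra. Qed.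

Lemma seminorm_lipschitz u v : `|N u - N v| <= N (u - v).
Proof.
rewrite ler_norml; have := NT (u - v) v.
have := NT (v - u) u; rewrite -(opprB u v) seminormN opprB !subrK.
by move=> *; apply/andP; split; lra.
Qed.

(** Expanding [v] in the canonical basis bounds [N v] by [B] times the maximum norm, and [N] is
    1-Lipschitz for itself. The summand 1 in [B] only keeps it positive for the division. The lemma
    is meant for the seminorm that measures one block of a vector. *)
Lemma seminorm_continuous : continuous N.
Proof.
pose B := \sum_i N (delta_mx 0 i) + 1.
have B0 : 0 < B by rewrite ltr_wpDl// sumr_ge0// => i _; exact: seminorm_ge0.
have NB v : N v <= B * `|v|.
  rewrite [v]row_sum_delta.
  have Nsum (I : Type) (s : seq I) (F : I -> 'rV[R]_m) :
      N (\sum_(i <- s) F i) <= \sum_(i <- s) N (F i).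
    elim: s => [|i s IH]; first by rewrite !big_nil seminorm0.
    by rewrite !big_cons (le_trans (NT _ _))// lerD2l.
  rewrite (le_trans (Nsum _ _ _))// -row_sum_delta /B mulrDl mul1r mulr_suml.
  rewrite ler_wpDr// ler_sum// => i _; rewrite NZ mulrC ler_wpM2l ?seminorm_ge0//.
  by rewrite [leRHS]mx_normrE; exact: (le_bigmax _ (fun ij => `|v ij.1 ij.2|) (0, i)).
move=> v; apply: (@cvgrPdist_le _ _ _ (nbhs v) _ _ _).2 => e e0; near=> u.
rewrite (le_trans (seminorm_lipschitz _ _))// (le_trans (NB _))// mulrC.
rewrite -ler_pdivlMr//; near: u.
by apply: ((@cvgrPdist_le _ _ _ (nbhs v) _ id v).1 (@cvg_id _ (nbhs v)));
  rewrite divr_gt0.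
Unshelve. all: by end_near. Qed.

End Seminorm.

(** * The transport cost of one block *)

Section BlockCost.
Context {R : realType} {n : nat} {d : 'I_n -> nat}.
Context (N : forall k, 'rV[R]_(d k) -> R) (hN : forall k, is_norm (@N k)).
Context (p : R) (p1 : 1 <= p).
Local Notation D := (\sum_k d k)%N.
Implicit Types z x : 'rV[R]_D.

Lemma block_cost_ge0 z x k : 0 <= block_cost N p z x k.
Proof. exact: powR_ge0. Qed.

Lemma block_costC z x k : block_cost N p z x k = block_cost N p x z k.
Proof. by case: (hN k) => _ NZ _; rewrite /block_cost -(seminormN NZ) opprB. Qed.

(** As zero to the power zero is 1, a nonzero exponent matters here; [p1] provides it. *)
Lemma block_costxx x k : block_cost N p x x k = 0.
Proof.
case: (hN k) => _ NZ _.
by rewrite /block_cost subrr (seminorm0 NZ) powR0// gt_eqF// (lt_le_trans ltr01).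
Qed.

Lemma measurable_block_cost x k :
  measurable_fun [set: borel_rV R D] (fun z => block_cost N p x z k).
Proof.
case: (hN k) => _ NZ NT.
have cN : continuous (fun z => N (submxrow (x - z) k)).
  move=> z; apply: (@continuous_comp _ _ _ (fun z => x - z)
    (fun z : 'rV[R]_D => N (submxrow z k))).
    by apply: (@continuousB _ _ _ (cst x) id z); [exact: cst_continuous|exact: cvg_id].
  apply: seminorm_continuous => [a v|u v].
    by rewrite -NZ; congr N; apply/matrixP => i j; rewrite !mxE.
  have -> : submxrow (u + v) k = submxrow u k + submxrow v k.
    by apply/matrixP => i j; rewrite !mxE.
  exact: NT.
rewrite (_ : (fun z => _) =
  (fun y => y `^ p) \o (fun z => N (submxrow (x - z) k))); last first.
  apply/funext => z; rewrite /block_cost/=; congr (N _ `^ p).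
  by apply/matrixP => i j; rewrite !mxE.
exact: measurableT_comp (measurable_powR p) (continuous_borel_rV cN).
Qed.

End BlockCost.

(** * Weak duality along a transport plan *)

Section WeakDuality.
Context {R : realType} {n M : nat} {d : 'I_n -> nat}.
Context (N : forall k, 'rV[R]_(d k) -> R) (hN : forall k, is_norm (@N k)).
Context (p : R) (p1 : 1 <= p).
Local Notation D := (\sum_k d k)%N.
Context (Xi : set 'rV[R]_D) (hXi : closed Xi).
Context (theta : 'I_M -> R) (atom : 'I_M -> 'rV[R]_D).
Context (theta_gt0 : forall l, 0 < theta l) (theta1 : \sum_l theta l = 1).
Context (hatom : forall l, Xi (atom l)).
Context (Q : probability (borel_rV R D) R).
Context (hQ : forall A, measurable A ->
     Q A = (\sum_l (theta l)%:E * \d_(atom l : borel_rV R D) A)%E).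
Context (eps : 'rV[R]_n).

(* Atoms may coincide, so the mass of an atom is shared among its labels. *)
Let mass l := \sum_(m | atom m == atom l) theta m.
Let w l := theta l / mass l.

Let mass_gt0 l : 0 < mass l.
Proof.
rewrite /mass (bigD1 l)//= ltr_pwDl ?theta_gt0// sumr_ge0// => m _.
exact/ltW.
Qed.

Let w_ge0 l : 0 <= w l.
Proof. by rewrite divr_ge0// ltW. Qed.

Let sum_w m : \sum_(l | atom l == atom m) w l = 1.
Proof.
rewrite (eq_bigr (fun l => theta l / mass m)) => [|l /eqP lm].
  by rewrite -mulr_suml -/(mass m) divff// gt_eqF.
by rewrite /w /mass lm.
Qed.

Let indic_atom l m : \1_[set atom l] (atom m) = (atom l == atom m)%:R :> R.
Proof.
rewrite indicE; congr (_%:R); case: eqP => [->|lm]; first by rewrite mem_set.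
by rewrite memNset// => /esym.
Qed.

Let measurable_atom l : measurable ([set atom l] : set (borel_rV R D)).
Proof.
have : closed [set (atom l : 'rV[R]_D)].
  by apply: compact_closed; [exact: norm_hausdorff|exact: compact_set1].
exact: closed_borel_rV.
Qed.

(** The first coordinate of the plan is almost surely an atom, where the constraints of its labels
    bound [h] at the second coordinate. Integrating them turns the costs into at most the budgets
    and the [s l] into their [theta]-average. Since [+oo * 0 = 0] on both sides, infinite
    multipliers are covered. *)
Lemma transport_dual_bound (h : 'rV[R]_D -> R) (lam : 'I_n -> \bar R)
    (s : 'I_M -> R) (P : probability (borel_rV R D) R) :
  measurable_fun (Xi : set (borel_rV R D)) h ->
  (forall xi, Xi xi -> 0 <= h xi) ->
  (forall k, 0 <= lam k)%E -> (forall l, 0 <= s l) ->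
  (forall l xi, Xi xi -> ((h xi)%:E <=
     (s l)%:E + \sum_k lam k * (block_cost N p xi (atom l) k)%:E)%E) ->
  transport_rectangle Xi N p Q eps P ->
  (\int[P]_(xi in Xi) (h xi)%:E <=
   \sum_k lam k * (eps 0 k `^ p)%:E + (\sum_l theta l * s l)%:E)%E.
Proof.
move=> mh h0 lam0 s0 hs [pi [piXi pi1 pi2 pic]].
have mXi : measurable (Xi : set (borel_rV R D)) by exact: closed_borel_rV.
pose A0 : set (borel_rV R D) := \bigcup_(l in [set: 'I_M]) [set atom l].
have mA0 : measurable A0 by exact: fin_bigcup_measurable.
have A0P z : A0 z <-> exists l, z = atom l.
  by split=> [[l _ ->]|[l ->]]; exists l.
(* The double complement is the form in which [ge0_negligible_integral] removes the null set of
   points whose first coordinate is not an atom. *)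
pose Om' : set (borel_rV R D * borel_rV R D) := snd @^-1` Xi `\` ~` (fst @^-1` A0).
have mfst (B : set (borel_rV R D)) : measurable B ->
    measurable ((fst : borel_rV R D * borel_rV R D -> _) @^-1` B).
  by move=> mB; rewrite -[_ @^-1` _]setTI; exact: measurable_fst.
have mOm1 : measurable ((snd : borel_rV R D * borel_rV R D -> _) @^-1` Xi).
  by rewrite -[_ @^-1` _]setTI; exact: measurable_snd.
have mOm' : measurable Om' by exact: (measurableD mOm1 (measurableC (mfst _ mA0))).
have piA0 : pi (~` (fst @^-1` A0)) = 0%E.
  rewrite probability_setC; last exact: (mfst _ mA0).
  have -> : pi (fst @^-1` A0) = 1%E.
    rewrite [LHS](pi1 _ mA0) hQ// -[RHS](congr1 EFin theta1) -sumEFin.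
    apply: eq_bigr => l _; rewrite diracE mem_set ?mule1//.
    by apply/A0P; exists l.
  by rewrite subee.
have OmP z : Om' z -> exists2 m, z.1 = atom m & Xi z.2.
  by move=> [z2 /contrapT/A0P[m z1]]; exists m.
(* On [Om'], [S] is the [w]-average of [s] over the labels of the first coordinate, and [G k] is the
   cost of block [k]. As sums over labels they are measurable on the product, [G k] because the cost
   is measurable in its second point when the first is an atom. *)
pose S (z : borel_rV R D * borel_rV R D) :=
  \sum_l w l * s l * \1_(fst @^-1` [set atom l]) z.
pose G k (z : borel_rV R D * borel_rV R D) :=
  \sum_l w l * \1_(fst @^-1` [set atom l]) z * block_cost N p (atom l) z.2 k.
have sumw1 (F : 'I_M -> R) (z : borel_rV R D * borel_rV R D) m : z.1 = atom m ->
    \sum_l w l * F l * \1_(fst @^-1` [set atom l]) z =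
    \sum_(l | atom l == atom m) w l * F l.
  move=> zm; rewrite [RHS]big_mkcond; apply: eq_bigr => l _.
  have -> : \1_(fst @^-1` [set atom l]) z = (atom l == atom m)%:R :> R.
    by rewrite -indic_atom -zm !indicE.
  by case: eqP => _; rewrite ?mulr1 ?mulr0.
have GE k z m : z.1 = atom m -> G k z = block_cost N p z.1 z.2 k.
  move=> zm; rewrite /G.
  transitivity (\sum_l w l * block_cost N p (atom l) z.2 k *
      \1_(fst @^-1` [set atom l]) z).
    by apply: eq_bigr => l _; exact: mulrAC.
  rewrite (sumw1 (fun l => block_cost N p (atom l) z.2 k) _ m)//.
  transitivity (\sum_(l | atom l == atom m) w l * block_cost N p z.1 z.2 k).
    by apply: eq_bigr => l /eqP ->; rewrite zm.
  by rewrite -mulr_suml sum_w mul1r.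
have indic_ge0 l (z : borel_rV R D * borel_rV R D) :
    0 <= \1_(fst @^-1` [set atom l]) z :> R by rewrite indicE ler0n.
have S0 z : 0 <= S z.
  by apply: sumr_ge0 => l _; rewrite mulr_ge0// mulr_ge0.
have G0 k z : 0 <= G k z.
  by apply: sumr_ge0 => l _; rewrite mulr_ge0// ?block_cost_ge0// mulr_ge0.
have mE l : measurable_fun setT
    (\1_(fst @^-1` [set atom l]) : borel_rV R D * borel_rV R D -> R).
  by apply: measurable_indic; exact: mfst.
have mS : measurable_fun setT S.
  by apply: measurable_sum => l; apply: measurable_funM.
have mG k : measurable_fun setT (G k).
  apply: measurable_sum => l; apply: measurable_funM.
    by apply: measurable_funM.
  apply: (measurableT_comp (f := fun y : borel_rV R D => block_cost N p (atom l) y k)).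
    exact: measurable_block_cost.
  exact: measurable_snd.
have -> : (\int[P]_(xi in Xi) (h xi)%:E = \int[pi]_(z in Om') (h z.2)%:E)%E.
  transitivity (\int[pushforward pi snd]_(xi in (Xi : set (borel_rV R D))) (h xi)%:E)%E.
    by apply: eq_measure_integral => A mA _; rewrite [RHS]pi2.
  rewrite ge0_integral_pushforward//; first last.
  - by move=> xi /set_mem /h0; rewrite lee_fin.
  - exact/measurable_EFinP.
  rewrite (ge0_negligible_integral (N := ~` (fst @^-1` A0)))//.
  - exact: measurableC (mfst _ mA0).
  - apply/measurable_EFinP.
    apply: (measurable_comp mXi _ mh); first by move=> _ [z hz <-].
    exact: (measurable_funTS (@measurable_snd _ _ (borel_rV R D) (borel_rV R D))).
  - by move=> z /h0; rewrite /= lee_fin.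
have hSG z : Om' z -> ((h z.2)%:E <= (S z)%:E + \sum_k lam k * (G k z)%:E)%E.
  move=> /OmP[m zm z2].
  have -> : (\sum_k lam k * (G k z)%:E =
             \sum_k lam k * (block_cost N p z.2 (atom m) k)%:E)%E.
    by apply: eq_bigr => k _; rewrite (GE k z m zm) zm block_costC.
  have : (0 <= \sum_k lam k * (block_cost N p z.2 (atom m) k)%:E)%E.
    by apply: sume_ge0 => k _; rewrite mule_ge0// lee_fin block_cost_ge0.
  (* An infinite penalty makes the bound trivial. Otherwise the constraints of all labels of the
     same atom are averaged with the weights [w], which sum to one. *)
  case E : (\sum_k _)%E => [L| |]// _; last by rewrite addey// leey.
  rewrite -EFinD lee_fin -lerBlDr /S (sumw1 s _ m)//.
  rewrite -[leLHS]mul1r -(sum_w m) mulr_suml ler_sum// => l /eqP lm.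
  rewrite ler_wpM2l// lerBlDr; have := hs l _ z2.
  by rewrite lm E -EFinD lee_fin.
have h0' z : Om' z -> (0 <= (h z.2)%:E)%E.
  by move=> /OmP[m _ /h0]; rewrite lee_fin.
apply: (le_trans (ge0_le_integral_nonmeasurable pi h0' hSG)).
rewrite ge0_integralD//; first last.
- apply: emeasurable_sum => k; apply: measurable_funeM.
  exact/measurable_EFinP/measurable_funTS.
- by move=> z _; apply: sume_ge0 => k _; rewrite mule_ge0// lee_fin.
- exact/measurable_EFinP/measurable_funTS.
- by move=> z _; rewrite lee_fin.
rewrite addeC leeD//.
- rewrite ge0_integral_sum//; first last.
  + by move=> k z _; rewrite mule_ge0// lee_fin.
  + move=> k; apply: measurable_funeM; exact/measurable_EFinP/measurable_funTS.
  apply: lee_sum => k _; rewrite ge0_integralZl//; first last.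
  + by move=> z _; rewrite lee_fin.
  + exact/measurable_EFinP/measurable_funTS.
  rewrite lee_wpmul2l// (le_trans _ (pic k))//.
  rewrite (eq_integral (fun z : borel_rV R D * borel_rV R D =>
    (block_cost N p z.1 z.2 k)%:E)); last first.
    by move=> z /set_mem/OmP[m zm _]; rewrite (GE k z m zm).
  apply: ge0_le_integral_subset => [z _|z /OmP[m zm z2]].
    by rewrite lee_fin block_cost_ge0.
  by split=> //; rewrite zm.
- apply: (@le_trans _ _ (\int[pi]_z (S z)%:E)%E).
    by apply: ge0_le_integral_subset => // z _; rewrite lee_fin.
  under eq_integral do rewrite /S -sumEFin.
  rewrite ge0_integral_sum//; first last.
  + by move=> l z _; rewrite lee_fin mulr_ge0// mulr_ge0.
  + by move=> l; apply/measurable_EFinP; apply: measurable_funM.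
  rewrite -sumEFin; apply: lee_sum => l _.
  under eq_integral do rewrite EFinM.
  rewrite ge0_integralZl_EFin//; first last.
  + by rewrite mulr_ge0.
  + exact/measurable_EFinP.
  rewrite integral_indic//; last exact: mfst.
  rewrite setIT [X in (_ * X)%E](pi1 _ (measurable_atom l)) hQ//.
  (* [Q] gives the point [atom l] the mass of all its labels together, and
     [w l * mass l = theta l]. *)
  rewrite (_ : (\sum_m _)%E = (mass l)%:E).
    by rewrite -EFinM lee_fin mulrAC /w divfK// gt_eqF.
  rewrite /mass [X in _ = X%:E]big_mkcond -sumEFin; apply: eq_bigr => m _.
  rewrite /dirac indic_atom eq_sym -EFinM.
  by case: eqP => _; rewrite ?mulr1 ?mulr0.
Qed.

End WeakDuality.

(** * The alternative for finitely many pairs of an atom and a point *)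

Section LPAlternative.
Context {R : realFieldType} {n M : nat} {J : finType}.
Context (e : 'I_n -> R) (theta : 'I_M -> R) (alpha : R).
Context (lab : J -> 'I_M) (c : 'I_n -> J -> R) (g : J -> R).

Let V : finType := ('I_n + 'I_M + 'I_1)%type.
(** Beside the constraints of [J] there is one row for each variable: the sign of [lam k] or of
    [s l], and, in the slot of [tau], whose sign is free, the budget. Row [i] reads
    [\sum_v a i v * x v + b i <= 0]. *)
Let I : finType := (J + V)%type.

Let a (i : I) (v : V) : R :=
  match i, v with
  | inl j, inl (inl k) => - c k j
  | inl j, inl (inr l) => - (l == lab j)%:R
  | inl j, inr _ => 1
  | inr (inl (inl k')), inl (inl k) => - (k == k')%:R
  | inr (inl (inr l')), inl (inr l) => - (l == l')%:R
  | inr (inr _), inl (inl k) => e k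
  | inr (inr _), inl (inr l) => theta l
  | inr (inr _), inr _ => - alpha
  | _, _ => 0
  end.

Let b (i : I) : R := if i is inl j then g j else 0.

Let sum_delta (T : finType) (t : T) (F : T -> R) :
  \sum_i (i == t)%:R * F i = F t.
Proof.
rewrite (bigD1 t)//= eqxx mul1r big1 ?addr0// => i /negbTE ->.
by rewrite mul0r.
Qed.

Let sum0l (T : finType) (F : T -> R) : \sum_i 0 * F i = 0.
Proof. by rewrite big1// => i _; rewrite mul0r. Qed.

Let sum0r (T : finType) (F : T -> R) : \sum_i F i * 0 = 0.
Proof. by rewrite big1// => i _; rewrite mulr0. Qed.

(** The certificate of Farkas' lemma is divided by the weight [y] of the budget row. The columns of
    [lam k], [s l] and [tau] then become the cost bounds, the mass bounds and the total mass; the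
    weights of the sign rows are the slacks. *)
Lemma lp_alternative :
  (exists (lam : 'I_n -> R) (tau : R) (s : 'I_M -> R),
    [/\ forall k, 0 <= lam k, forall l, 0 <= s l,
      \sum_k lam k * e k + \sum_l theta l * s l <= tau * alpha
    & forall j, g j + tau - \sum_k lam k * c k j <= s (lab j)]) \/
  (exists u : J -> R,
    [/\ forall j, 0 <= u j, \sum_j u j = alpha,
      forall l, \sum_(j | lab j == l) u j <= theta l,
      forall k, \sum_j u j * c k j <= e k & 0 < \sum_j u j * g j]).
Proof.
have [[x hx]|[w [w0 wa wb]]] := farkas_seq (index_enum_uniq V) a b.
- left; exists (fun k => x (inl (inl k))), (x (inr ord0)), (fun l => x (inl (inr l))).
  split=> [k|l||j].
  + have := hx (inr (inl (inl k))); rewrite !big_sumType big_ord1/= mul0r.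
    rewrite sum0l.
    under eq_bigr do rewrite mulNr.
    by rewrite sumrN sum_delta; lra.
  + have := hx (inr (inl (inr l))); rewrite !big_sumType big_ord1/= mul0r.
    rewrite sum0l.
    under eq_bigr do rewrite mulNr.
    by rewrite sumrN sum_delta; lra.
  + have := hx (inr (inr ord0)); rewrite !big_sumType big_ord1/=.
    by under eq_bigr do rewrite mulrC; lra.
  + have := hx (inl j); rewrite !big_sumType big_ord1/=.
    under eq_bigr do rewrite mulNr mulrC.
    under [X in _ + X + _]eq_bigr do rewrite mulNr.
    by rewrite !sumrN sum_delta; lra.
- pose y := w (inr (inr ord0)); pose q j := w (inl j).
  have eqV v : \sum_j q j * a (inl j) v +
      (\sum_k w (inr (inl (inl k))) * a (inr (inl (inl k))) v +
       \sum_l w (inr (inl (inr l))) * a (inr (inl (inr l))) v +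
       y * a (inr (inr ord0)) v) = 0.
    by have := wa v (mem_index_enum v); rewrite !big_sumType big_ord1.
  have qc k : \sum_j q j * c k j <= y * e k.
    have := eqV (inl (inl k)); rewrite /=.
    under eq_bigr do rewrite mulrN.
    rewrite sumrN sum0r.
    under [X in _ + (X + _ + _)]eq_bigr => k' _ do
      rewrite mulrN mulrC eq_sym.
    by rewrite sumrN sum_delta; have := w0 (inr (inl (inl k))); lra.
  have qs l : \sum_(j | lab j == l) q j <= y * theta l.
    have := eqV (inl (inr l)); rewrite /=.
    under eq_bigr do rewrite mulrN.
    rewrite sumrN sum0r.
    under [X in _ + (_ + X + _)]eq_bigr => k' _ do
      rewrite mulrN mulrC eq_sym.
    rewrite sumrN sum_delta [X in X <= _]big_mkcond/=.
    rewrite [X in - X](eq_bigr (fun j => if lab j == l then q j else 0)).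
      by have := w0 (inr (inl (inr l))); lra.
    by move=> j _; rewrite eq_sym; case: eqP; rewrite ?mulr1 ?mulr0.
  have qa : \sum_j q j = y * alpha.
    have := eqV (inr ord0); rewrite /=.
    under eq_bigr do rewrite mulr1.
    rewrite sum0r.
    rewrite sum0r.
    by lra.
  have qg : 0 < \sum_j q j * g j.
    move: wb; rewrite !big_sumType big_ord1/=.
    rewrite sum0r.
    rewrite sum0r.
    by rewrite mulr0 !addr0.
  (* If [y] were zero, the column of [tau] would force every [q j] to vanish, against [qg]. *)
  have y0 : 0 < y.
    rewrite lt_neqAle w0 andbT eq_sym; apply/eqP => y0.
    move: qg; rewrite big1 ?ltxx// => j _.
    move: qa; rewrite y0 mul0r => /eqP.
    rewrite psumr_eq0; last by move=> i _; exact: w0.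
    by move/allP => /(_ j (mem_index_enum j))/eqP ->; rewrite mul0r.
  right; exists (fun j => q j / y); split.
  + by move=> j; rewrite divr_ge0 ?w0// ltW.
  + by rewrite -mulr_suml qa mulrAC divff ?mul1r// gt_eqF.
  + by move=> l; rewrite -mulr_suml ler_pdivrMr// mulrC.
  + move=> k; under eq_bigr do rewrite mulrAC.
    by rewrite -mulr_suml ler_pdivrMr// mulrC.
  + under eq_bigr do rewrite mulrAC.
    by rewrite -mulr_suml divr_gt0.
Qed.

End LPAlternative.

(** * Infinite linear systems in a box *)

Section CompactSolvability.
Context {R : realType} {V : finType} {I : choiceType}.
Context (a : I -> V -> R) (b : I -> R) (S : set I) (lo hi : V -> R).

(** Finite intersection property of the closed solution sets in the compact box. Each set of the
    family is cut with the box, and [i0] provides one from which the bounds on the common point are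
    read off. *)
Lemma compact_solvability (i0 : I) : S i0 ->
  (forall F : {fset I}, {subset F <= S} -> exists x : V -> R,
    (forall v, lo v <= x v <= hi v) /\
    (forall i, i \in F -> \sum_v a i v * x v + b i <= 0)) ->
  exists x : V -> R, (forall v, lo v <= x v <= hi v) /\
    (forall i, S i -> \sum_v a i v * x v + b i <= 0).
Proof.
move=> Si0 fin.
pose A : set 'rV[R]_#|V| :=
  [set u | forall i, `[lo (enum_val i), hi (enum_val i)]%classic (u ord0 i)].
have cA : compact A by apply: (@rV_compact R #|V|
    (fun i => `[lo (enum_val i), hi (enum_val i)]%classic)) => i;
    exact: segment_compact.
pose G i : set 'rV[R]_#|V| :=
  [set u | \sum_v a i v * u ord0 (enum_rank v) + b i <= 0].
have clG i : closed (G i).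
  apply: (continuous_closedP _).1 (@closed_le R 0).
  move=> u; apply: continuousD; last exact: cst_continuous.
  apply: (@continuous_big _ _ +%R); first exact: add_continuous.
  move=> v _ {}u; apply: continuousM; first exact: cst_continuous.
  exact: coord_continuous.
have := cA; rewrite compact_In0 => /(_ I S (fun i => A `&` G i)).
case.
- by exists G.
- move=> F FS; have [x [xb xF]] := fin F FS.
  exists (\row_j x (enum_val j)) => i /= iF; split=> [j|].
    by rewrite /= mxE in_itv/=; exact: xb.
  rewrite /G/=; have := xF i iF.
  by under [in X in _ -> X]eq_bigr do rewrite mxE enum_rankK.
- move=> u uAG; exists (fun v => u ord0 (enum_rank v)); split=> [v|i Si].
    by have [/(_ (enum_rank v)) + _] := uAG _ Si0; rewrite /= enum_rankK in_itv.
  by have [_] := uAG _ Si.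
Qed.

End CompactSolvability.

(** * From robustness to multipliers *)

Section StrongDuality.
Context {R : realType} {n M : nat} {d : 'I_n -> nat}.
Context (N : forall k, 'rV[R]_(d k) -> R) (hN : forall k, is_norm (@N k)).
Context (p : R) (p1 : 1 <= p).
Local Notation D := (\sum_k d k)%N.
Context (Xi : set 'rV[R]_D) (hXi : closed Xi).
Context (theta : 'I_M -> R) (atom : 'I_M -> 'rV[R]_D).
Context (theta_gt0 : forall l, 0 < theta l) (theta1 : \sum_l theta l = 1).
Context (hatom : forall l, Xi (atom l)).
Context (Q : probability (borel_rV R D) R).
Context (hQ : forall A, measurable A ->
     Q A = (\sum_l (theta l)%:E * \d_(atom l : borel_rV R D) A)%E).
Context (eps : 'rV[R]_n) (eps_ge0 : forall k, 0 <= eps 0 k).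
Context (alpha : R) (halpha : 0 < alpha < 1).
Context (g : 'rV[R]_D -> R) (mg : measurable_fun (Xi : set (borel_rV R D)) g).

Let risk (P : probability (borel_rV R D) R) (tau : R) :=
  (\int[P]_(xi in Xi) (Num.max (g xi + tau) 0 - tau * alpha)%:E)%E.

(* The mass that the certificate [u] does not move stays at its atom. *)
Lemma certificate_plan (J : finType) (lab : J -> 'I_M) (zeta : J -> 'rV[R]_D)
    (u : J -> R) :
  (forall j, Xi (zeta j)) -> (forall j, 0 <= u j) -> \sum_j u j = alpha ->
  (forall l, \sum_(j | lab j == l) u j <= theta l) ->
  (forall k, \sum_j u j * block_cost N p (zeta j) (atom (lab j)) k
             <= eps 0 k `^ p) ->
  exists2 P, transport_rectangle Xi N p Q eps P &
    forall tau, ((\sum_j u j * g (zeta j))%:E <= risk P tau)%E.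
Proof.
move=> Xizeta u0 ualpha utheta ucost.
pose K : finType := (J + 'I_M)%type.
pose w (i : K) := match i with
  | inl j => u j
  | inr l => theta l - \sum_(j | lab j == l) u j end.
pose z1 (i : K) : borel_rV R D :=
  match i with inl j => atom (lab j) | inr l => atom l end.
pose z2 (i : K) : borel_rV R D :=
  match i with inl j => zeta j | inr l => atom l end.
have usum (F : 'I_M -> R) :
    \sum_l (\sum_(j | lab j == l) u j) * F l = \sum_j u j * F (lab j).
  rewrite [RHS](partition_big lab xpredT)//=; apply: eq_bigr => l _.
  by rewrite mulr_suml; apply: eq_bigr => j /eqP ->.
have w0 i : 0 <= w i by case: i => [j|l] /=; rewrite ?subr_ge0.
(* The first marginal is [Q]: at each atom, moved and retained mass add up to [theta l]. *)
have wz1 (F : 'I_M -> R) : \sum_j u j * F (lab j) +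
    \sum_l (theta l - \sum_(j | lab j == l) u j) * F l = \sum_l theta l * F l.
  rewrite -usum -big_split/=; apply: eq_bigr => l _; ring.
have w1 : \sum_i w i = 1.
  rewrite big_sumType/= -[RHS]theta1.
  transitivity (\sum_l theta l * 1); last by apply: eq_bigr => l _; rewrite mulr1.
  by rewrite -(wz1 (fun=> 1)); congr (_ + _); apply: eq_bigr => i _; rewrite mulr1.
have [pi [piE _ pi_le]] := @finite_probability _ (borel_rV R D * borel_rV R D)%type
  R K w (fun i => (z1 i, z2 i)) w0 w1.
have [P [PE intP _]] := @finite_probability _ (borel_rV R D) R K w z2 w0 w1.
have Xiz1 i : Xi (z1 i) by case: i => [j|l] /=.
have Xiz2 i : Xi (z2 i) by case: i => [j|l] /=.
exists P.
  exists pi; split.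
  - rewrite piE -[RHS](congr1 EFin w1) -sumEFin; apply: eq_bigr => i _.
    by rewrite diracE mem_set ?mule1//; split; [exact: Xiz1|exact: Xiz2].
  - move=> A mA; rewrite /pushforward piE hQ// big_sumType/=.
    have := congr1 EFin (wz1 (fun l => \1_A (atom l))).
    by rewrite EFinD -!sumEFin.
  - by move=> A mA; rewrite /pushforward piE PE.
  - move=> k; apply: le_trans (pi_le _ _ _ _) _ => [i|z _|].
      by split; [exact: Xiz1|exact: Xiz2].
      by rewrite lee_fin block_cost_ge0.
    rewrite (_ : (\sum_i _)%E =
        (\sum_j u j * block_cost N p (zeta j) (atom (lab j)) k)%:E).
      by rewrite lee_fin.
    rewrite big_sumType/= [X in (_ + X)%E]big1 => [|l _]; last first.
      by rewrite block_costxx// mule0.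
    rewrite adde0 -sumEFin; apply: eq_bigr => j _.
    by rewrite block_costC.
move=> tau; rewrite /risk.
have mXi : measurable (Xi : set (borel_rV R D)) by exact: closed_borel_rV.
pose h (xi : borel_rV R D) : R := Num.max (g xi + tau) 0.
have h0 xi : 0 <= h xi by rewrite le_max lexx orbT.
have mh : measurable_fun (Xi : set (borel_rV R D)) h.
  by apply: measurable_maxr => //; exact: measurable_funD.
have PXi : P Xi = 1%E.
  rewrite PE -[RHS](congr1 EFin w1) -sumEFin; apply: eq_bigr => i _.
  by rewrite diracE mem_set ?mule1.
have intPE : (\int[P]_(xi in Xi) (h xi)%:E = (\sum_i w i * h (z2 i))%:E)%E.
  have mEh : measurable_fun (Xi : set (borel_rV R D)) (EFin \o h).
    exact/measurable_EFinP.
  rewrite (intP _ _ mXi mEh) => [|xi _]; last by rewrite lee_fin.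
  rewrite -sumEFin; apply: eq_bigr => i _.
  by rewrite diracE mem_set ?mul1e.
rewrite (integralB_cst (h := h) (tau * alpha))// intPE ?ltry//.
(* As the moved mass is [alpha], [tau * alpha] is the sum of the [u j * tau]. The retained mass
   contributes a nonnegative amount and is dropped, and [h] is at least [g + tau] at the moved
   points. *)
rewrite -EFinB lee_fin lerBrDr -ualpha mulr_sumr -big_split/= big_sumType/=.
rewrite ler_wpDr//; first by apply: sumr_ge0 => l _; exact: mulr_ge0 (w0 (inr l)) _.
apply: ler_sum => j _; rewrite [tau * _]mulrC -mulrDr ler_wpM2l//.
by rewrite le_max lexx.
Qed.

(* Blocks with a zero budget cannot move, so only the pairs (l, xi) with
   xi_k = xi_k^l on those blocks are constraints, and finite multipliers
   suffice. The atoms themselves confine every solution to a fixed box. *)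
Lemma robust_multipliers :
  (forall P, transport_rectangle Xi N p Q eps P ->
    (ereal_inf [set risk P tau | tau in [set: R]] <= 0)%E) ->
  exists (lam : 'I_n -> R) (tau : R) (s : 'I_M -> R),
  [/\ forall k, 0 <= lam k, forall l, 0 <= s l,
    \sum_k lam k * eps 0 k `^ p + \sum_l theta l * s l <= tau * alpha
  & forall l xi, Xi xi ->
    (forall k, eps 0 k = 0 -> block_cost N p xi (atom l) k = 0) ->
    g xi + tau - \sum_k lam k * block_cost N p xi (atom l) k <= s l].
Proof.
move=> rob; have /andP[a0 a1] := halpha.
pose e k := eps 0 k `^ p.
have e_ge0 k : 0 <= e k by exact: powR_ge0.
have e0 k : eps 0 k = 0 -> e k = 0.
  by move=> ek; rewrite /e ek powR0// gt_eqF// (lt_le_trans ltr01).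
have e_gt0 k : eps 0 k != 0 -> 0 < e k.
  by move=> ek; rewrite powR_gt0// lt_neqAle eq_sym ek eps_ge0.
pose V : finType := ('I_n + 'I_M + 'I_1)%type.
pose I : choiceType := ('I_M * 'rV[R]_D + 'I_1)%type.
pose a (i : I) (v : V) : R :=
  match i, v with
  | inl q, inl (inl k) => - block_cost N p q.2 (atom q.1) k
  | inl q, inl (inr l) => - (l == q.1)%:R
  | inl q, inr _ => 1
  | inr _, inl (inl k) => e k
  | inr _, inl (inr l) => theta l
  | inr _, inr _ => - alpha
  end.
pose b (i : I) : R := if i is inl q then g q.2 else 0.
pose admissible (q : 'I_M * 'rV[R]_D) := Xi q.2 /\
  forall k, eps 0 k = 0 -> block_cost N p q.2 (atom q.1) k = 0.
pose S : set I := [set i | if i is inl q then admissible q else True].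
(* At an atom all costs vanish, so [g (atom l) + tau <= s l]. Averaging and inserting the budget
   gives [(1 - alpha) * tau <= - \sum_l theta l * g (atom l)], that is, [tau <= T]. Each term of the
   budget is then at most [T * alpha]. *)
pose T := - (\sum_l theta l * g (atom l)) / (1 - alpha).
(* For a zero budget, [e k = 0] and division by zero yields 0, so the box pins that multiplier to
   0. *)
pose hi (v : V) : R := match v with
  | inl (inl k) => T * alpha / e k
  | inl (inr l) => T * alpha / theta l
  | inr _ => T end.
have aE i (x : V -> R) : \sum_v a i v * x v =
    \sum_k a i (inl (inl k)) * x (inl (inl k)) +
    \sum_l a i (inl (inr l)) * x (inl (inr l)) + a i (inr ord0) * x (inr ord0).
  by rewrite !big_sumType big_ord1.
have sum_delta (l0 : 'I_M) (F : 'I_M -> R) : \sum_l - (l == l0)%:R * F l = - F l0.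
  rewrite (bigD1 l0)//= eqxx mulN1r big1 ?addr0// => i /negbTE ->.
  by rewrite oppr0 mul0r.
have aqE q (x : V -> R) : \sum_v a (inl q) v * x v + b (inl q) =
    g q.2 + x (inr ord0) -
    \sum_k x (inl (inl k)) * block_cost N p q.2 (atom q.1) k -
    x (inl (inr q.1)).
  rewrite aE /= sum_delta (eq_bigr (fun k =>
    - (x (inl (inl k)) * block_cost N p q.2 (atom q.1) k))) => [|k _].
    by rewrite sumrN; ring.
  by rewrite mulNr mulrC.
have abE (x : V -> R) : \sum_v a (inr ord0) v * x v + b (inr ord0) =
    \sum_k x (inl (inl k)) * e k + \sum_l theta l * x (inl (inr l)) -
    x (inr ord0) * alpha.
  rewrite aE /= (eq_bigr (fun k => x (inl (inl k)) * e k)) => [|k _].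
    by ring.
  by rewrite mulrC.
have [|F FS|x [xb xS]] := @compact_solvability R V I a b S (fun=> 0) hi (inr ord0).
- by [].
- have [l0 _] : exists l : 'I_M, True.
    apply: contrapT => noM; have : \sum_l theta l = 0.
      by apply: big1 => l _; case: noM; exists l.
    by rewrite theta1 => /eqP; rewrite oner_eq0.
  (* The atoms' own constraints join every finite subsystem, for the bounds of the box. The budget
     row is built into [lp_alternative]; if it occurs in [F], an atom constraint takes its place. *)
  pose J : finType := ('I_M + F)%type.
  pose pt (j : J) : 'I_M * 'rV[R]_D := match j with
    | inl l => (l, atom l)
    | inr i => if fsval i is inl q then q else (l0, atom l0) end.
  have adm_atom l : admissible (l, atom l).
    by split=> [|k _]; [exact: hatom|exact: block_costxx].
  have adm j : admissible (pt j).
    case: j => [l|i] /=; first exact: adm_atom.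
    have /set_mem := FS _ (fsvalP i); rewrite /S /=.
    by case: (fsval i) => // _ _; exact: adm_atom.
  have [sol|[u [u0 ua ut uc ug]]] := lp_alternative e theta alpha
    (fun j => (pt j).1) (fun k j => block_cost N p (pt j).2 (atom (pt j).1) k)
    (fun j => g (pt j).2); last first.
    have [P TP Pg] := certificate_plan (fun j => (adm j).1) u0 ua ut uc.
    have := rob P TP; rewrite leNgt => /negP[].
    apply: (@lt_le_trans _ _ (\sum_j u j * g (pt j).2)%:E); first by rewrite lte_fin.
    by apply/ereal_infP => _ [tau _ <-].
  have {sol} [lam [tau [s [lam0 s0 bud sol]]]] := sol.
  (* On admissible pairs a block with zero budget has zero cost, so its multiplier can be reset to
     0, as the box demands, without affecting any constraint. *)
  pose lam' k := if eps 0 k == 0 then 0 else lam k.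
  have lamE j : \sum_k lam' k * block_cost N p (pt j).2 (atom (pt j).1) k =
      \sum_k lam k * block_cost N p (pt j).2 (atom (pt j).1) k.
    apply: eq_bigr => k _; rewrite /lam'; case: eqP => // ek.
    by rewrite (adm j).2// !mulr0.
  have lameE : \sum_k lam' k * e k = \sum_k lam k * e k.
    by apply: eq_bigr => k _; rewrite /lam'; case: eqP => // /e0 ->; rewrite !mulr0.
  have lam'0 k : 0 <= lam' k by rewrite /lam'; case: ifP.
  have ts0 l : 0 <= theta l * s l by rewrite mulr_ge0// ltW.
  have le0 k : 0 <= lam' k * e k by rewrite mulr_ge0.
  have sumts0 : 0 <= \sum_l theta l * s l by apply: sumr_ge0.
  have sumle0 : 0 <= \sum_k lam' k * e k by apply: sumr_ge0.
  rewrite -lameE in bud.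
  have sg l : g (atom l) + tau <= s l.
    have := sol (inl l); rewrite /= big1 ?subr0// => k _.
    by rewrite block_costxx// mulr0.
  have tsg : \sum_l theta l * g (atom l) + tau <= \sum_l theta l * s l.
    rewrite -[tau]mul1r -theta1 mulr_suml -big_split/= ler_sum// => l _.
    by rewrite -mulrDr ler_wpM2l// ltW.
  have tau0 : 0 <= tau by rewrite -(pmulr_lge0 _ a0); lra.
  have tauT : tau <= T by rewrite /T ler_pdivlMr ?subr_gt0//; lra.
  have tauTa : tau * alpha <= T * alpha by rewrite ler_wpM2r// ltW.
  exists (fun v : V => match v with
    | inl (inl k) => lam' k | inl (inr l) => s l | inr _ => tau end).
  split.
    case=> [[k|l]|o] /=; apply/andP; split => //.
    + rewrite /lam'; case: (eqVneq (eps 0 k) 0) => [/e0 ->|ek].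
        by rewrite invr0 mulr0.
      rewrite ler_pdivlMr ?e_gt0//.
      have : lam' k * e k <= \sum_k lam' k * e k.
        by rewrite (bigD1 k)//= lerDl sumr_ge0.
      by rewrite /lam' (negbTE ek); move: sumle0; rewrite /lam'; lra.
    + rewrite ler_pdivlMr// mulrC.
      have : theta l * s l <= \sum_l theta l * s l.
        by rewrite (bigD1 l)//= lerDl sumr_ge0.
      by lra.
  case=> [q|o] iF.
    have := sol (inr [` iF]%fset); rewrite -lamE /= aqE /=; lra.
  by rewrite (ord1 o) abE; lra.
- exists (fun k => x (inl (inl k))), (x (inr ord0)), (fun l => x (inl (inr l))).
  split=> [k|l||l xi Xixi zxi].
  + by have /andP[] := xb (inl (inl k)).
  + by have /andP[] := xb (inl (inr l)).
  + by have := xS (inr ord0) Logic.I; rewrite abE; lra.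
  + by have := xS (inl (l, xi)) (conj Xixi zxi); rewrite aqE /=; lra.
Qed.

End StrongDuality.

(** * Convexity of the constraints and inclusions between the sets *)

Section Reformulation.
Context {R : realType} {ell n M : nat} {d : 'I_n -> nat}.
Context (N : forall k, 'rV[R]_(d k) -> R) (hN : forall k, is_norm (@N k)).
Context (p : R) (p1 : 1 <= p) (alpha : R) (halpha : 0 < alpha < 1).
Local Notation D := (\sum_k d k)%N.
Context (X : set 'rV[R]_ell) (Xi : set 'rV[R]_D).
Context (theta : 'I_M -> R) (atom : 'I_M -> 'rV[R]_D) (eps : 'rV[R]_n).
Context (f : 'rV[R]_ell -> 'rV[R]_D -> R).

(** The budget constraint is affine in [(lam, tau, s)]. The other is a supremum over [xi] of
    functions that are convex in [x] and affine in the remaining variables. *)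
Lemma convex_constraints :
  (forall xi, Xi xi -> convex_function X (fun x => f x xi)) ->
  constraints_convex X Xi N p alpha theta atom eps f.
Proof.
move=> fcv; split=> [t y z t01 _ _|l t y z /andP[t0 t1] [yX ? ?] [zX ? ?]].
  rewrite -!EFinM -EFinD lee_fin le_eqVlt; apply/orP; left; apply/eqP.
  rewrite /budget_lhs /=.
  rewrite (eq_bigr (fun k => t * (y.1.1.2 0 k * eps 0 k `^ p) +
    (1 - t) * (z.1.1.2 0 k * eps 0 k `^ p))) => [|k _]; last by rewrite !mxE; ring.
  rewrite [X in _ + X - _](eq_bigr (fun l => t * (theta l * y.2 0 l) +
    (1 - t) * (theta l * z.2 0 l))) => [|l _]; last by rewrite !mxE; ring.
  by rewrite !big_split/= -!mulr_sumr /GRing.scale/=; ring.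
rewrite leeBlDr//; apply: ge_ereal_sup => _ [xi Xixi <-].
rewrite -leeBlDr//.
pose val (v : 'rV[R]_ell * 'rV[R]_n * R^o * 'rV[R]_M) : R :=
  f v.1.1.1 xi + v.1.2 - \sum_k v.1.1.2 0 k * block_cost N p xi (atom l) k -
  v.2 0 l.
have le_val (u : R) (v : 'rV[R]_ell * 'rV[R]_n * R^o * 'rV[R]_M) : 0 <= u ->
    ((u * val v)%:E <= u%:E *
      (penalized_sup Xi N p atom f v.1.1.1 v.1.1.2 v.1.2 l - (v.2 0 l)%:E))%E.
  move=> u0; rewrite EFinM lee_wpmul2l ?lee_fin// /val EFinB leeB//.
  by apply: ereal_sup_ubound; exists xi.
apply: le_trans (leeD (le_val t y t0) (le_val (1 - t) z _)); last by rewrite subr_ge0.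
rewrite -EFinB -EFinD lee_fin.
have fle : f (t *: y.1.1.1 + (1 - t) *: z.1.1.1) xi <=
    t * f y.1.1.1 xi + (1 - t) * f z.1.1.1 xi.
  exact: (fcv xi Xixi (Itv01 t0 t1) y.1.1.1 z.1.1.1 (mem_set yX) (mem_set zX)).
rewrite /val /=.
rewrite (eq_bigr (fun k => t * (y.1.1.2 0 k * block_cost N p xi (atom l) k) +
    (1 - t) * (z.1.1.2 0 k * block_cost N p xi (atom l) k))) => [|k _];
  last by rewrite !mxE; ring.
rewrite !big_split/= -!mulr_sumr !mxE.
rewrite /GRing.scale/= in fle *; lra.
Qed.

Lemma reformulated_sub_ereformulated :
  reformulated_set X Xi N p alpha theta atom eps f `<=`
  ereformulated_set X Xi N p alpha theta atom eps f.
Proof.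
move=> x [Xx [lam [tau [s [lam0 s0 bud pen]]]]]; split=> //.
exists (fun k => (lam 0 k)%:E), tau, s; split=> // [|l].
  by rewrite sumEFin -EFinD lee_fin.
apply: ge_ereal_sup => _ [xi Xixi <-]; apply: le_trans (pen l).
by apply: ereal_sup_ubound; exists xi => //; rewrite sumEFin -EFinB.
Qed.

(** With positive budgets a single infinite multiplier would make the left side of the budget
    constraint infinite. *)
Lemma ereformulated_sub_reformulated :
  (forall l, 0 < theta l) -> (forall k, 0 < eps 0 k) ->
  ereformulated_set X Xi N p alpha theta atom eps f `<=`
  reformulated_set X Xi N p alpha theta atom eps f.
Proof.
move=> theta_gt0 eps0 x [Xx [lam [tau [s [lam0 s0 bud pen]]]]]; split=> //.
have e0 k : 0 < eps 0 k `^ p by rewrite powR_gt0.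
have lam_fin k : lam k = (fine (lam k))%:E.
  rewrite fineK// ge0_fin_numE//; rewrite ltNge leye_eq; apply/eqP => lamk.
  move: bud; rewrite (bigD1 k)//= lamk gt0_mulye ?lte_fin// -addeA addye ?leye_eq//.
  rewrite gt_eqF// (lt_le_trans (ltNyr 0))// adde_ge0//.
    by apply: sume_ge0 => i _; rewrite mule_ge0// lee_fin ltW.
  by rewrite lee_fin sumr_ge0// => l _; rewrite mulr_ge0// ltW.
exists (\row_k fine (lam k)), tau, s; split=> // [k||l].
- by rewrite mxE fine_ge0.
- rewrite -lee_fin (le_trans _ bud)// EFinD leeD2r// -sumEFin.
  by apply: lee_sum => k _; rewrite mxE EFinM -lam_fin.
- apply: ge_ereal_sup => _ [xi Xixi <-]; apply: le_trans (pen l).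
  apply: ereal_sup_ubound; exists xi => //; rewrite EFinB; congr (_ - _)%E.
  by rewrite -sumEFin; apply: eq_bigr => k _; rewrite mxE EFinM -lam_fin.
Qed.

Context (hXi : closed Xi) (theta_gt0 : forall l, 0 < theta l).
Context (theta1 : \sum_l theta l = 1) (hatom : forall l, Xi (atom l)).
Context (eps_ge0 : forall k, 0 <= eps 0 k).
Context (Q : probability (borel_rV R D) R).
Context (hQ : forall A, measurable A ->
     Q A = (\sum_l (theta l)%:E * \d_(atom l : borel_rV R D) A)%E).
Context (f_cont : forall x, X x -> {within Xi, continuous (f x)}).

(** The infimum is at most the value at the given [tau], which weak duality bounds for the positive
    part [h]. The same bound shows that the integral of [h] is finite, so that [tau * alpha] can be
    split off. *)
Lemma ereformulated_sub_robust :
  ereformulated_set X Xi N p alpha theta atom eps f `<=`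
  robust_set X Xi N p alpha eps f Q.
Proof.
move=> x [Xx [lam [tau [s [lam0 s0 bud pen]]]]]; split=> //.
apply: ge_ereal_sup => _ [P TP <-]; apply: ge_ereal_inf.
eexists; first by exists tau.
have mXi : measurable (Xi : set (borel_rV R D)) by exact: closed_borel_rV.
have PXi : P Xi = 1%E.
  case: TP => pi [piXi _ pi2 _].
  apply/eqP; rewrite eq_le probability_le1//= -[P Xi]pi2// -[leLHS]piXi.
  have mOm : measurable ((snd : borel_rV R D * borel_rV R D -> _) @^-1` Xi).
    by rewrite -[_ @^-1` _]setTI; exact: measurable_snd.
  have mXX := measurableX mXi mXi.
  by apply: le_measure => [||z []//]; exact: mem_set.
pose h (xi : borel_rV R D) : R := Num.max (f x xi + tau) 0.
have h0 xi : 0 <= h xi by rewrite le_max lexx orbT.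
have mf : measurable_fun (Xi : set (borel_rV R D)) (f x).
  by apply: within_continuous_borel_rV => //; exact: f_cont.
have mh : measurable_fun (Xi : set (borel_rV R D)) h.
  by apply: measurable_maxr => //; exact: measurable_funD.
(* Both entries of the maximum are covered: [f x xi + tau] by the constraint, and 0 by the signs of
   [s] and of the penalty. *)
have hs l xi : Xi xi -> ((h xi)%:E <=
    (s 0 l)%:E + \sum_k lam k * (block_cost N p xi (atom l) k)%:E)%E.
  move=> Xixi.
  have L0 : (0 <= \sum_k lam k * (block_cost N p xi (atom l) k)%:E)%E.
    by apply: sume_ge0 => k _; rewrite mule_ge0// lee_fin block_cost_ge0.
  have fs : ((f x xi + tau)%:E - \sum_k lam k * (block_cost N p xi (atom l) k)%:E
      <= (s 0 l)%:E)%E.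
    by apply: le_trans (pen l); apply: ereal_sup_ubound; exists xi.
  case: (\sum_k _)%E L0 fs => [L| |]//; last by move=> _ _; rewrite addey// leey.
  rewrite -EFinB -EFinD !lee_fin /h ge_max => L0 fs; apply/andP; split; first by lra.
  by rewrite addr_ge0.
have intle := transport_dual_bound hN hXi theta_gt0 theta1 hatom hQ mh
  (fun xi _ => h0 xi) lam0
  (s0 : forall l, 0 <= (fun l => s 0 l) l) hs TP.
have intle' := le_trans intle bud.
rewrite (integralB_cst (h := h) (tau * alpha))//; last first.
  by rewrite (le_lt_trans intle')// ltry.
by rewrite sube_le0.
Qed.

(** The multipliers from [robust_multipliers] control only the points with zero cost on every block
    of zero budget. The multiplier [+oo] on those blocks sends the penalized value to [-oo] at all
    other points, and it is free because [+oo * 0 = 0]. *)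
Lemma robust_sub_ereformulated :
  robust_set X Xi N p alpha eps f Q `<=`
  ereformulated_set X Xi N p alpha theta atom eps f.
Proof.
move=> x [Xx rob]; split=> //.
have mf : measurable_fun (Xi : set (borel_rV R D)) (f x).
  by apply: within_continuous_borel_rV => //; exact: f_cont.
have [|lam [tau [s [lam0 s0 bud pen]]]] := robust_multipliers hN p1 hXi
  theta_gt0 theta1 hatom hQ eps_ge0 halpha mf.
  by move=> P TP; apply: le_trans rob; apply: ereal_sup_ubound; exists P.
exists (fun k => if eps 0 k == 0 then +oo%E else (lam k)%:E), tau, (\row_l s l).
split=> [k|l||l].
- by case: ifP; rewrite ?leey ?lee_fin.
- by rewrite mxE.
- apply: le_trans (_ : ((\sum_k lam k * eps 0 k `^ p + \sum_l theta l * s l)%:E <= _)%E).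
    rewrite EFinD leeD//; last first.
      by rewrite lee_fin; apply: ler_sum => l _; rewrite mxE.
    rewrite -sumEFin; apply: lee_sum => k _; case: eqP => [->|_]//.
    by rewrite powR0 ?mule0 ?mulr0// gt_eqF// (lt_le_trans ltr01).
  by rewrite lee_fin.
- apply: ge_ereal_sup => _ [xi Xixi <-]; rewrite mxE.
  have [[k [ek ck]]|nk] := pselect (exists k, eps 0 k = 0 /\
      block_cost N p xi (atom l) k != 0).
    rewrite (_ : (\sum_k _)%E = +oo%E) ?addeNy ?leNye//.
    rewrite (bigD1 k)//= ek eqxx gt0_mulye; last first.
      by rewrite lte_fin lt_neqAle eq_sym ck block_cost_ge0.
    rewrite addye// gt_eqF// (lt_le_trans (ltNyr 0))//.
    apply: sume_ge0 => i _; rewrite mule_ge0//; last by rewrite lee_fin block_cost_ge0.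
    by case: ifP; rewrite ?leey ?lee_fin.
  have zc k : eps 0 k = 0 -> block_cost N p xi (atom l) k = 0.
    by move=> ek; apply: contrapT => /eqP ck; apply: nk; exists k.
  rewrite (_ : (\sum_k _)%E = (\sum_k lam k * block_cost N p xi (atom l) k)%:E).
    by rewrite -EFinB lee_fin; exact: pen.
  rewrite -sumEFin; apply: eq_bigr => k _; case: eqP => [/zc ->|//].
  by rewrite mule0 mulr0.
Qed.

End Reformulation.

Theorem proposition7p2 (R : realType) (ell n M : nat) (d : 'I_n -> nat)
  (N : forall k : 'I_n, 'rV[R]_(d k) -> R)
  (N0 : 'rV[R]_(\sum_k d k) -> R)
  (hN : forall k, is_norm (N k)) (hN0 : is_norm N0)
  (p alpha : R) (hp : 1 <= p) (halpha : 0 < alpha < 1)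
  (X : set 'rV[R]_ell) (hXcl : closed X) (hXcv : convex_set X)
  (Xi : set 'rV[R]_(\sum_k d k)) (hXi : closed Xi)
  (theta : 'I_M -> R) (atom : 'I_M -> 'rV[R]_(\sum_k d k))
  (htheta : forall l, 0 < theta l) (htheta1 : \sum_l theta l = 1)
  (hatom : forall l, Xi (atom l))
  (Q : probability (borel_rV R (\sum_k d k)) R)
  (hQ : forall A, measurable A ->
     Q A = (\sum_l (theta l)%:E * \d_(atom l : borel_rV R (\sum_k d k)) A)%E)
  (eps : 'rV[R]_n) (heps : forall k, 0 <= eps 0 k)
  (f : 'rV[R]_ell -> 'rV[R]_(\sum_k d k) -> R)
  (hfcv : forall xi, Xi xi -> convex_function X (fun x => f x xi))
  (hf : exists r : R, [/\ 0 <= r, r < p & forall x, X x ->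
     {within Xi, continuous (f x)} /\ growth_class Xi N0 r (f x)]) :
  [/\ constraints_convex X Xi N p alpha theta atom eps f,
      reformulated_set X Xi N p alpha theta atom eps f
        `<=` robust_set X Xi N p alpha eps f Q,
      (forall k, 0 < eps 0 k) ->
        robust_set X Xi N p alpha eps f Q =
        reformulated_set X Xi N p alpha theta atom eps f
    & robust_set X Xi N p alpha eps f Q =
      ereformulated_set X Xi N p alpha theta atom eps f].
Proof.
have p1 := hp; case: hf => r [_ _ hfx].
have f_cont x : X x -> {within Xi, continuous (f x)} by case/hfx.
have weak : ereformulated_set X Xi N p alpha theta atom eps f `<=`
    robust_set X Xi N p alpha eps f Q by exact: ereformulated_sub_robust.
have strong : robust_set X Xi N p alpha eps f Q `<=`
    ereformulated_set X Xi N p alpha theta atom eps f.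
  exact: robust_sub_ereformulated.
have refine_sub := @reformulated_sub_ereformulated _ _ _ _ _ N p alpha X Xi
  theta atom eps f.
split.
- exact: convex_constraints.
- exact: subset_trans refine_sub weak.
- move=> eps0; apply/seteqP; split; last exact: subset_trans refine_sub weak.
  exact: subset_trans strong (ereformulated_sub_reformulated htheta eps0).
- by apply/seteqP; split.
Qed.
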